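(* Let $G$ be a connected nonbipartite graph of order $n$ with $m$ edges, let $\rho$ be the largest eigenvalue of its adjacency matrix, let $t$ be the number of triangles of $G$, and let $t''$ be the number of induced subgraphs of $G$ of order three having exactly one edge. Suppose that $(x_1,\ldots,x_n)$ is a positive unit eigenvector of the adjacency matrix for the eigenvalue $\rho$, and let \[ c=\frac{\min\{x_1,\ldots,x_n\}}{x_1+\cdots+x_n}. \] Then \[ \rho^3-\rho m+c\rho t''\leq 3t. \]
   Context: All graphs are finite and simple; ''unit'' means Euclidean norm $1$. *)

(* Defs.v *)
From HB Require Import structures.
From mathcomp Require Import all_boot all_order all_algebra.

Set Implicit Arguments.
Unset Strict Implicit.
Unset Printing Implicit Defensive.

Import Order.TTheory GRing.Theory Num.Theory.

Local Open Scope ring_scope.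

(* A finite simple graph of order n is a symmetric irreflexive relation on    *)
(* 'I_n; the definitions below are meant for such relations.                  *)

Definition simple_graph (n : nat) (e : rel 'I_n) : Prop :=
  symmetric e /\ irreflexive e.

Definition connected_graph (n : nat) (e : rel 'I_n) : Prop :=
  (0 < n)%N /\ forall u v : 'I_n, connect e u v.

Definition bipartite (n : nat) (e : rel 'I_n) : Prop :=
  exists A : {set 'I_n}, forall u v, e u v -> (u \in A) != (v \in A).

Definition edges (n : nat) (e : rel 'I_n) : {set {set 'I_n}} :=
  [set E | [exists u, exists v, e u v && (E == [set u; v])]].

Definition induced_edges (n : nat) (e : rel 'I_n) (S : {set 'I_n}) :
    {set {set 'I_n}} :=
  [set E in edges e | E \subset S].

Definition is_clique (n : nat) (e : rel 'I_n) (S : {set 'I_n}) : bool :=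
  [forall u in S, forall v in S, (u != v) ==> e u v].

Definition triangles (n : nat) (e : rel 'I_n) : {set {set 'I_n}} :=
  [set S : {set 'I_n} | (#|S| == 3)%N && is_clique e S].

Definition one_edge_triples (n : nat) (e : rel 'I_n) : {set {set 'I_n}} :=
  [set S : {set 'I_n} | (#|S| == 3)%N && (#|induced_edges e S| == 1)%N].

Definition adjacency_mx (R : nzRingType) (n : nat) (e : rel 'I_n) : 'M[R]_n :=
  \matrix_(i, j) (e i j)%:R.

Definition largest_eigenvalue (R : realFieldType) (n : nat) (A : 'M[R]_n)
    (rho : R) : Prop :=
  eigenvalue A rho /\ forall mu : R, eigenvalue A mu -> mu <= rho.

(* Row-vector convention, as for eigenvalue; adjacency matrices are symmetric.*)
Definition eigenvector (R : fieldType) (n : nat) (A : 'M[R]_n) (a : R)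
    (x : 'rV[R]_n) : Prop :=
  x != 0 /\ x *m A = a *: x.

Definition enorm (R : rcfType) (n : nat) (x : 'rV[R]_n) : R :=
  Num.sqrt (\sum_i x 0 i ^+ 2).

(* Least entry of x; the default value is the first entry (or 0 if n = 0), so *)
(* it never affects the minimum of a nonempty vector.                         *)
Definition min_entry (R : realFieldType) (n : nat) (x : 'rV[R]_n) : R :=
  let s := [seq x 0 i | i : 'I_n] in \big[Num.min/head 0 s]_(y <- s) y.

(* Main.v *)
Require Import Defs.
From HB Require Import structures.
From mathcomp Require Import all_boot all_order all_algebra.
From mathcomp Require Import ring lra.

Set Implicit Arguments.
Unset Strict Implicit.
Unset Printing Implicit Defensive.

Import Order.TTheory GRing.Theory Num.Theory.

Local Open Scope ring_scope.

(** For a vertex k, an edge uv is adjacent to k at none, one or both of its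
    ends.  Counting edges with weight x_k over all k, inclusion-exclusion and
    A x = rho x give, with s the sum of the entries of x, t_k the number of
    triangles at k and z_k the number of edges uv with k adjacent to neither
    u nor v,
      rho^2 s - m s + sum_k x_k z_k = sum_k x_k t_k.
    The z_k sum to t'', the t_k sum to 3t, and rho x_k <= s since rho x_k is
    the sum of x over the neighbours of k.  Multiply by rho / s.  Counting
    edges as ordered pairs doubles every term. *)

Section Fibres.

Variables (T U : finType) (f : T -> U) (D : {set T}) (B : {set U}) (k : nat).

Lemma card_fibre_leq :
  {in D, forall p, f p \in B} ->
  {in B, forall y, #|[set p in D | f p == y]| <= k}%N ->
  (#|D| <= k * #|B|)%N.
Proof.
move=> fDB fib; rewrite -sum1_card (partition_big f (mem B)) //=.
rewrite mulnC -sum_nat_const; apply: leq_sum => y /fib.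
by rewrite sum1dep_card.
Qed.

Lemma card_fibre_geq :
  {in B, forall y, k <= #|[set p in D | f p == y]|}%N ->
  (k * #|B| <= #|D|)%N.
Proof.
move=> fib; rewrite -(sum1_card (mem D)) (partition_big f predT) //=.
rewrite mulnC -sum_nat_const.
(* Fibres over points outside [B] only enlarge the right-hand side, so they are bounded below by
   0. *)
rewrite [leqRHS](bigID (mem B)) /= -[leqLHS]addn0 leq_add //.
apply: leq_sum => y /fib.
by rewrite sum1dep_card.
Qed.

End Fibres.

Lemma cards3P (T : finType) (S : {set T}) :
  #|S| = 3%N -> exists a b c, [/\ S = [set a; b; c], a != b, a != c & b != c].
Proof.
move=> S3; have /card_gt0P[a aS] : (0 < #|S|)%N by rewrite S3.
have /eqP/cards2P[b [c [bc Sa]]] : #|S :\ a| = 2%N.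
  by move: S3; rewrite (cardsD1 a) aS => -[].
have [] : b \in S :\ a /\ c \in S :\ a by rewrite Sa !inE !eqxx orbT.
rewrite !inE => /andP[ba _] /andP[ca _].
exists a, b, c; split=> //; try by rewrite eq_sym.
by rewrite -setUA -Sa setD1K.
Qed.

Section Counting.

Variables (n : nat) (e : rel 'I_n).
Hypothesis e_simple : simple_graph e.

Let V := 'I_n.
Let e_sym : symmetric e := e_simple.1.
Let e_irr : irreflexive e := e_simple.2.

Let adj_neq u v : e u v -> u != v.
Proof. by apply: contraTneq => ->; rewrite e_irr. Qed.

Definition vset (p : V * V * V) : {set V} := [set p.1.1; p.1.2; p.2].

Definition arcs : {set V * V} := [set p | e p.1 p.2].

(** In a triple [(k, u, v)] here and below, [k] carries the weight and [(u, v)] is an oriented edge.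
    A triangle thus arises from six triples. *)
Definition ordered_triangles : {set V * V * V} :=
  [set p | [&& e p.1.2 p.2, e p.1.1 p.1.2 & e p.1.1 p.2]].

(** Since [u] and [v] are adjacent, non-adjacency of [k] to both already forces [k] to differ from
    them. *)
Definition ordered_one_edge : {set V * V * V} :=
  [set p | [&& e p.1.2 p.2, ~~ e p.1.1 p.1.2 & ~~ e p.1.1 p.2]].

Lemma card_arcs_leq : (#|arcs| <= 2 * #|edges e|)%N.
Proof.
apply: (@card_fibre_leq _ _ (fun p : V * V => [set p.1; p.2])) => [[u v]|E].
  rewrite !inE /= => uv.
  by apply/existsP; exists u; apply/existsP; exists v; rewrite uv eqxx.
rewrite inE => /existsP[u /existsP[v /andP[uv /eqP->]]].
apply: leq_trans (_ : #|[set (u, v); (v, u)]| <= 2)%N; last first.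
  by rewrite cards2; case: eqP.
apply/subset_leq_card/subsetP => -[a b]; rewrite !inE /=.
case/andP=> /adj_neq ab /eqP Eab.
have [] : a \in [set u; v] /\ b \in [set u; v] by rewrite -Eab !inE !eqxx orbT.
rewrite !inE !xpair_eqE => /orP[]/eqP ea /orP[]/eqP eb; move: ab;
  by rewrite ea eb ?eqxx ?orbT.
Qed.

Lemma card_ordered_triangles_leq :
  (#|ordered_triangles| <= 6 * #|triangles e|)%N.
Proof.
apply: (@card_fibre_leq _ _ vset) => [[[k u] v]|S].
  rewrite !inE /vset /= => /and3P[uv ku kv].
  have [kNu kNv uNv] := And3 (adj_neq ku) (adj_neq kv) (adj_neq uv).
  rewrite -setUA cardsU1 cards2 !inE negb_or kNu kNv uNv /=.
  apply/forall_inP => a aS; apply/forall_inP => b bS.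
  apply/implyP; move: aS bS; rewrite !inE.
  by do 2!case/or3P=> /eqP->; rewrite ?eqxx // e_sym.
rewrite inE => /andP[/eqP/cards3P[a [b [c [-> ab ac bc]]]] _].
pose L := [:: (a, b, c); (a, c, b); (b, a, c); (b, c, a); (c, a, b); (c, b, a)].
apply: leq_trans (card_size L).
apply/subset_leq_card/subsetP => -[[k u] v]; rewrite !inE /vset /=.
case/andP=> /and3P[/adj_neq uv /adj_neq ku /adj_neq kv] /eqP S_eq.
have : [/\ k \in [set a; b; c], u \in [set a; b; c] & v \in [set a; b; c]].
  by rewrite -S_eq !inE !eqxx !orbT.
rewrite !inE -!orbA => -[kS uS vS]; move: uv ku kv.
(* Of the 27 assignments, those repeating a vertex contradict adjacency; the other six are listed in
   [L]. *)
by case/or3P: kS => /eqP->; case/or3P: uS => /eqP->; case/or3P: vS => /eqP->;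
  rewrite !xpair_eqE !eqxx ?orbT.
Qed.

(** The vertex off the single edge must come first, and the two ends of the edge can follow in
    either order. *)
Lemma card_ordered_one_edge_geq :
  (2 * #|one_edge_triples e| <= #|ordered_one_edge|)%N.
Proof.
apply: (@card_fibre_geq _ _ vset) => S.
rewrite inE => /andP[/eqP S3 /cards1P[E indE]].
have : E \in induced_edges e S by rewrite indE set11.
rewrite inE => /andP[]; rewrite inE.
case/existsP=> u /existsP[v /andP[uv /eqP EE]].
move=> ES; have uNv := adj_neq uv.
have /eqP/cards1P[k Sk] : #|S :\: E| = 1%N.
  by rewrite cardsD (setIidPr ES) S3 EE cards2 uNv.
have /setDP[kS kE] : k \in S :\: E by rewrite Sk set11.
(* An edge from [k] into [E] would be a second induced edge, as it contains [k] and [E] does not. *)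
have nadj w : w \in E -> ~~ e k w.
  move=> wE; apply: contra kE => kw.
  suff : [set k; w] \in induced_edges e S.
    by rewrite indE inE => /eqP<-; rewrite !inE eqxx.
  rewrite !inE; apply/andP; split.
    by apply/existsP; exists k; apply/existsP; exists w; rewrite kw eqxx.
  by apply/subsetP => z; rewrite !inE => /orP[]/eqP-> //; apply: (subsetP ES).
have SE : S = [set k] :|: E.
  by rewrite -{1}(setID S E) (setIidPr ES) Sk setUC.
have ku : ~~ e k u by apply: nadj; rewrite EE !inE eqxx.
have kv : ~~ e k v by apply: nadj; rewrite EE !inE eqxx orbT.
apply: leq_trans (_ : 2 <= #|[set (k, u, v); (k, v, u)]|)%N _.
  by rewrite cards2 !xpair_eqE eqxx (negPf uNv).
apply/subset_leq_card/subsetP => p.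
rewrite !inE => /orP[]/eqP->; rewrite /vset /= ?(e_sym v u) uv ku kv SE EE /=.
  by rewrite setUA.
by rewrite (setUC [set u]) setUA.
Qed.

End Counting.

Lemma min_entry_le (R : realFieldType) (n : nat) (x : 'rV[R]_n) i :
  min_entry x <= x 0 i.
Proof.
by apply: (ge_bigmin_seq _ _ xpredT id) => //; apply: map_f; rewrite mem_enum.
Qed.

Lemma min_entry_ge0 (R : realFieldType) (n : nat) (x : 'rV[R]_n) :
  (forall i, 0 <= x 0 i) -> 0 <= min_entry x.
Proof.
move=> x_ge0; rewrite /min_entry; set r := [seq _ | _ : _].
have r_ge0 y : y \in r -> 0 <= y by case/mapP => i _ ->.
rewrite big_seq le_bigmin //.
(* What remains is the default of the minimum: 0 for an empty list, otherwise the first entry. *)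
by case: (r) r_ge0 => //= y l; apply; rewrite mem_head.
Qed.

Section WeightedCount.

Variables (R : realFieldType) (n : nat) (e : rel 'I_n) (rho : R).
Variable x : 'rV[R]_n.
Hypothesis e_simple : simple_graph e.
Hypothesis x_eigen : x *m adjacency_mx R e = rho *: x.

Let s := \sum_i x 0 i.

Lemma eigen_nbr_sum u : \sum_k x 0 k * (e k u)%:R = rho * x 0 u.
Proof.
move/rowP/(_ u): x_eigen; rewrite !mxE => <-.
by apply: eq_bigr => k _; rewrite mxE.
Qed.

Lemma sum_triples (F : 'I_n -> 'I_n -> 'I_n -> R) :
  \sum_k \sum_u \sum_v F k u v = \sum_p F p.1.1 p.1.2 p.2.
Proof. by rewrite pair_bigA /= pair_bigA. Qed.

Lemma weighted_count :
  \sum_(p in ordered_one_edge e) x 0 p.1.1 =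
  s * #|arcs e|%:R - 2 * rho ^+ 2 * s +
  \sum_(p in ordered_triangles e) x 0 p.1.1.
Proof.
have e_sym := e_simple.1.
have arcsE : #|arcs e|%:R = \sum_u \sum_v (e u v)%:R :> R.
  rewrite pair_bigA /= -sum1_card natr_sum big_mkcond /=.
  by apply: eq_bigr => p _; rewrite inE; case: (e _ _).
(* The eigenvalue equation has turned the sum over [k] into [rho * x 0 u]; summing over the
   neighbours of [v] uses it a second time. *)
have half : \sum_u \sum_v (e u v)%:R * (rho * x 0 u) = rho ^+ 2 * s.
  rewrite exchange_big /= expr2 -mulrA !mulr_sumr; apply: eq_bigr => v _.
  rewrite -eigen_nbr_sum mulr_sumr; apply: eq_bigr => u _; ring.
have half' : \sum_u \sum_v (e u v)%:R * (rho * x 0 v) = rho ^+ 2 * s.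
  rewrite -half exchange_big; apply: eq_bigr => u _.
  by apply: eq_bigr => v _; rewrite e_sym.
(* The sum over [k] is moved innermost, so that both sides can be compared for a fixed pair [u],
   [v]. *)
have sumE (D : {set 'I_n * 'I_n * 'I_n}) (F : 'I_n -> 'I_n -> 'I_n -> R) :
    (forall p, (if p \in D then x 0 p.1.1 else 0) = F p.1.1 p.1.2 p.2) ->
    \sum_(p in D) x 0 p.1.1 = \sum_u \sum_v \sum_k F k u v.
  move=> DF; rewrite big_mkcond (eq_bigr _ (fun p _ => DF p)) -sum_triples.
  by rewrite exchange_big; apply: eq_bigr => u _; rewrite exchange_big.
rewrite (sumE _ (fun k u v => x 0 k * (e u v)%:R * (1 - (e k u)%:R)
   * (1 - (e k v)%:R))); last first.
  by move=> p; rewrite inE; do 3!case: (e _ _) => /=; ring.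
rewrite (sumE _ (fun k u v => x 0 k * (e u v)%:R * (e k u)%:R * (e k v)%:R));
  last first.
  by move=> p; rewrite inE; do 3!case: (e _ _) => /=; ring.
have -> : 2 * rho ^+ 2 * s = rho ^+ 2 * s + rho ^+ 2 * s by ring.
rewrite arcsE -{1}half -half' mulr_sumr opprD addrA -!sumrB -big_split /=.
apply: eq_bigr => u _; rewrite mulr_sumr -!sumrB -big_split /=.
apply: eq_bigr => v _.
(* With every term written as a sum over [k], the claim is [(1 - a) * (1 - b) = 1 - a - b + a * b]
   for the indicators of [k] being adjacent to [u] and to [v]. *)
rewrite -!eigen_nbr_sum mulr_suml !mulr_sumr -!sumrB -big_split /=.
by apply: eq_bigr => k _; ring.
Qed.

End WeightedCount.

Theorem theorem5 (R : rcfType) (n : nat) (e : rel 'I_n) (rho : R)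
    (x : 'rV[R]_n)
    (e_simple : simple_graph e)
    (e_conn : connected_graph e)
    (e_nonbip : ~ bipartite e)
    (rho_max : largest_eigenvalue (adjacency_mx R e) rho)
    (x_eigen : eigenvector (adjacency_mx R e) rho x)
    (x_pos : forall i, 0 < x 0 i)
    (x_unit : enorm x = 1) :
  let m := #|edges e| in
  let t := #|triangles e| in
  let t'' := #|one_edge_triples e| in
  let c := min_entry x / \sum_i x 0 i in
  rho ^+ 3 - rho * m%:R + c * rho * t''%:R <= 3%:R * t%:R.
Proof.
cbv zeta; set m := #|edges e|; set t := #|triangles e|.
set t'' := #|one_edge_triples e|.
have [n_gt0 _] := e_conn; have [_ xA] := x_eigen.
have nbr := eigen_nbr_sum xA.
have x_ge0 i : 0 <= x 0 i := ltW (x_pos i).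
have term_ge0 u k : 0 <= x 0 k * (e k u)%:R by rewrite mulr_ge0 ?ler0n.
pose i0 := Ordinal n_gt0.
have rho_ge0 : 0 <= rho.
  by rewrite -(pmulr_lge0 _ (x_pos i0)) -nbr sumr_ge0.
have count := weighted_count e_simple xA.
set s := \sum_i x 0 i in count *.
have s_gt0 : 0 < s.
  by rewrite /s (bigD1 i0) //= ltr_pwDl ?sumr_ge0.
have rho_x k : rho * x 0 k <= s.
  rewrite -nbr; apply: ler_sum => j _.
  by rewrite ler_piMr // lern1; case: (e _ _).
have m_bound : #|arcs e|%:R <= 2 * m%:R :> R.
  by rewrite -natrM ler_nat card_arcs_leq.
have t_bound :
    rho * \sum_(p in ordered_triangles e) x 0 p.1.1 <= s * (6 * t%:R).
  rewrite mulr_sumr; apply: le_trans (_ : s * #|ordered_triangles e|%:R <= _).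
    rewrite mulr_natr -sumr_const; exact: ler_sum.
  by rewrite ler_pM2l // -natrM ler_nat card_ordered_triangles_leq.
have t''_bound :
    min_entry x * (2 * t''%:R) <= \sum_(p in ordered_one_edge e) x 0 p.1.1.
  (* The count is bounded first, which needs the least entry to be nonnegative; then each weight
     is. *)
  apply: le_trans (_ : min_entry x * #|ordered_one_edge e|%:R <= _).
    rewrite ler_wpM2l ?min_entry_ge0 // -natrM ler_nat.
    exact: card_ordered_one_edge_geq.
  rewrite mulr_natr -sumr_const; apply: ler_sum => p _; exact: min_entry_le.
have m_s := ler_wpM2l (mulr_ge0 rho_ge0 (ltW s_gt0)) m_bound.
have t''_s := ler_wpM2l rho_ge0 t''_bound.
(* Clearing the denominator [s] of [c] leaves a linear combination of the three bounds, with
   products of the variables as atoms. *)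
rewrite -(ler_pM2l s_gt0).
have -> : s * (rho ^+ 3 - rho * m%:R + min_entry x / s * rho * t''%:R) =
  s * rho ^+ 3 - rho * s * m%:R + rho * (min_entry x * t''%:R).
  by field; rewrite gt_eqF.
move: t''_s t_bound m_s; rewrite count; lra.
Qed.
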